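(* Let $G$ be a Lie group and let $H\subset G$ be a closed subgroup. Let $X$ be a Hamiltonian $G$-space and let $Y$ be a Hamiltonian $H$-space. Then $$\mathrm{Hom}_G(X,\mathrm{Ind}_H^G Y)=\mathrm{Hom}_H(\mathrm{Res}_H^G X,Y),$$ where the equality denotes a diffeological diffeomorphism; that is, there is a bijection between the two sides, endowed with their reduction diffeologies, which is smooth with smooth inverse in the sense of diffeology.
   Context: All manifolds and Lie groups are finite dimensional and smooth. **Diffeology.** A parametrization of a set $X$ is a map $U\to X$ with $U$ an open subset of some $\mathbb{R}^p$, $p\in\mathbb{N}$. A diffeology on a nonempty set $X$ is a set of parametrizations of $X$, called plots, that contains all constant parametrizations, contains every parametrization that is locally (in a neighbourhood of each point of its domain) a plot, and is closed under precomposition with $C^\infty$ maps between open subsets of Euclidean spaces. A map $f:X\to X'$ of diffeological spaces is smooth if $f\circ P$ is a plot of $X'$ for every plot $P$ of $X$. A diffeological diffeomorphism is a smooth bijection with smooth inverse. A manifold is a diffeological space whose plots are the $C^\infty$ parametrizations. A subset $A\subset X$ carries the subset diffeology: its plots are the plots of $X$ with values in $A$. A quotient $\pi:X\to X/\mathcal{R}$ carries the quotient diffeology: $P:U\to X/\mathcal R$ is a plot iff each $r\in U$ has an open neighbourhood $V$ and a plot $Q:V\to X$ with $P|_V=\pi\circ Q$. **Hamiltonian spaces.** A Hamiltonian $G$-space $(X,\omega,\Phi)$ is a symplectic manifold $(X,\omega)$ with a smooth $G$-action preserving $\omega$ and a $G$-equivariant moment map $\Phi:X\to\mathfrak{g}^*$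 (convention: $\omega(Z_X,\cdot)=-d\langle\Phi,Z\rangle$ for $Z\in\mathfrak g$, where $Z_X$ is the infinitesimal action). $X^-$ denotes $X$ with the same action, and with opposite $2$-form $-\omega$ and opposite moment map $-\Phi$. Products carry the sum of the forms, the diagonal action and the sum of the moment maps. For closed $H\subset G$, $\mathrm{Res}_H^G X$ is $X$ with the restricted $H$-action and moment map $x\mapsto\Phi(x)|_{\mathfrak h}$. **Reduction.** $X/\!/G:=\Phi^{-1}(0)/G$, where $\Phi^{-1}(0)\subset X$ has the subset diffeology and the orbit space has the quotient diffeology. ($0$ need not be a regular value and the action need not be free or proper.) **Induction.** Let $(Y,\omega_Y,\Psi)$ be a Hamiltonian $H$-space. For $p\in T_q^*G$ and $g\in G$, write $gp\in T^*_{gq}G$ and $pg\in T^*_{qg}G$ for the lifted left and right translations; in particular $pq^{-1},\,q^{-1}p\in T_e^*G=\mathfrak g^*$. Let $\varpi$ be the canonical $1$-form on $T^*G$: $\varpi(\delta p)=\langle p,\delta q\rangle$, where $\delta q$ is the projection of $\delta p\in T_p(T^*G)$ to $T_qG$. Put $N=T^*G\times Y$ with symplectic form $d\varpi+\omega_Y$ and $G\times H$-action $(g,h)(p,y)=(gph^{-1},h(y))$. Its moment map is $\phi\times\psi:N\to\mathfrak g^*\times\mathfrak h^*$ with $\phi(p,y)=pq^{-1}$ and $\psi(p,y)=\Psi(y)-q^{-1}p|_{\mathfrak h}$ (for $p\in T_q^*G$). The induced manifold is $\mathrm{Ind}_H^G Y:=N/\!/H=\psi^{-1}(0)/H$. The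 $H$-action on $N$ is free and proper, so this is a symplectic manifold, and it is a Hamiltonian $G$-space with the residual $G$-action and the moment map induced by $\phi$. **Intertwiner space.** For Hamiltonian $G$-spaces $X_1,X_2$, $\mathrm{Hom}_G(X_1,X_2):=(X_1^-\times X_2)/\!/G$. *)

(* Defs.v *)
From HB Require Import structures.
From mathcomp Require Import all_boot all_order all_algebra.
From mathcomp Require Import boolp classical_sets functions reals topology normedtype.
From mathcomp Require Import landau derive ring.
Set Implicit Arguments.
Unset Strict Implicit.
Unset Printing Implicit Defensive.
Import Order.TTheory GRing.Theory Num.Theory.
Import numFieldNormedType.Exports.
Local Open Scope classical_set_scope.
Local Open Scope ring_scope.

(* Maps are total functions on R^n, but C^k-regularity is asserted only on the
   open set U: Frechet differentiability with C^(k-1) directional derivatives.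
   It depends only on the values of f on U (lemma Ck_ext). *)
Fixpoint Ck (R : realType) (n : nat) (W : normedModType R) (k : nat)
    (U : set 'rV[R]_n) (f : 'rV[R]_n -> W) : Prop :=
  match k with
  | 0 => forall x, U x -> {for x, continuous f}
  | k'.+1 => (forall x, U x -> differentiable f x) /\
             forall v, Ck k' U (fun x => 'D_v f x)
  end.

Definition Cinfty (R : realType) (n : nat) (W : normedModType R)
    (U : set 'rV[R]_n) (f : 'rV[R]_n -> W) : Prop := forall k, Ck k U f.

Section Calculus.
Context {R : realType}.

Lemma near0_differentiable n (W : normedModType R) (f : 'rV[R]_n -> W) x :
  (\near x, f x = 0) -> differentiable f x.
Proof.
move=> f0; have fx0 : f x = 0 by exact: nbhs_singleton f0.
have H : f \o shift x = cst (f x) + (\0 : {linear 'rV[R]_n -> W}) +o_ 0 id.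
  apply/eqaddoP => e e0 /=.
  have H0 : \forall z \near (0 : 'rV[R]_n), f (z + x) = 0.
    by move: f0; rewrite (near_shift 0) /= subr0.
  near=> y; rewrite -[leLHS]/(`|f (y + x) - (f x + 0)|) fx0 addr0 subr0.
  have -> : f (y + x) = 0 by near: y.
  by rewrite normr0 mulr_ge0 // ltW.
apply/diff_locallyP.
have c0 : continuous (\0 : {linear 'rV[R]_n -> W}) by exact: cst_continuous.
by rewrite (diff_unique c0 H).
Unshelve. all: by end_near. Qed.

Lemma near_eq_differentiable n (W : normedModType R) (f g : 'rV[R]_n -> W) x :
  (\near x, f x = g x) -> differentiable f x -> differentiable g x.
Proof.
move=> fg df; rewrite (_ : g = f + (g - f)); last first.
  by apply/funext => y; rewrite addrC subrK.
apply: differentiableD => //; apply: near0_differentiable.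
near=> y; rewrite -[LHS]/(g y - f y).
by apply/eqP; rewrite subr_eq0 eq_sym; apply/eqP; near: y.
Unshelve. all: by end_near. Qed.

Lemma Ck_ext n (W : normedModType R) k U (f g : 'rV[R]_n -> W) : open U ->
  (forall x, U x -> f x = g x) -> Ck k U f -> Ck k U g.
Proof.
elim: k f g => [|k IH] f g oU fg /=.
  move=> cf x Ux.
  have nfg : \near x, f x = g x by near=> y; apply: fg; near: y; exact: open_nbhs_nbhs.
  rewrite /prop_for/continuous_at -(fg _ Ux).
  exact: cvg_trans (near_eq_cvg nfg) (cf x Ux).
move=> [df Df]; split=> [x Ux|v].
  apply: near_eq_differentiable (df x Ux).
  by near=> y; apply: fg; near: y; exact: open_nbhs_nbhs.
apply: (IH (fun x => 'D_v f x)) => // x Ux.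
apply: near_eq_derive.
by near=> y; apply: fg; near: y; exact: open_nbhs_nbhs.
Unshelve. all: by end_near. Qed.

Lemma Ck_sub n (W : normedModType R) k U V (f : 'rV[R]_n -> W) :
  V `<=` U -> Ck k U f -> Ck k V f.
Proof.
move=> VU; elim: k f => [|k IH] f /=; first by move=> cf x /VU; exact: cf.
by move=> [df Df]; split=> [x /VU /df//|v]; exact: IH.
Qed.

Lemma Ck_local n (W : normedModType R) k U (f : 'rV[R]_n -> W) :
  (forall x, U x -> exists2 V, V x & Ck k V f) -> Ck k U f.
Proof.
elim: k f => [|k IH] f /= H; first by move=> x /H[V Vx]; exact.
split=> [x /H[V Vx [df _]]|v]; first exact: df.
by apply: IH => x /H[V Vx [_ Df]]; exists V.
Qed.

Lemma CkS n (W : normedModType R) k U (f : 'rV[R]_n -> W) :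
  Ck k.+1 U f -> Ck k U f.
Proof.
elim: k f => [|k IH] f [df Df].
  by move=> x /df; exact: differentiable_continuous.
by split=> // v; apply: IH.
Qed.

Lemma Ck_cst n (W : normedModType R) k U (c : W) : Ck k U (fun _ : 'rV[R]_n => c).
Proof.
elim: k c => [|k IH] c; first by move=> x _; exact: cst_continuous.
split=> [x _|v]; first exact: differentiable_cst.
suff -> : (fun x => 'D_v (fun _ : 'rV[R]_n => c) x) = fun=> 0 by [].
by apply/funext => x; rewrite derive_cst.
Qed.

Lemma CkD n (W : normedModType R) k U (f g : 'rV[R]_n -> W) : open U ->
  Ck k U f -> Ck k U g -> Ck k U (fun x => f x + g x).
Proof.
move=> oU; elim: k f g => [|k IH] f g.
  by move=> cf cg x Ux; apply: continuousD; [exact: cf|exact: cg].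
move=> [df Df] [dg Dg]; split=> [x Ux|v].
  by apply: differentiableD; [exact: df|exact: dg].
apply: Ck_ext (IH _ _ (Df v) (Dg v)) => // x Ux.
by rewrite [RHS]deriveD//; apply: diff_derivable; [exact: df|exact: dg].
Qed.

Lemma Ck_sum n (W : normedModType R) k U m (f : 'I_m -> 'rV[R]_n -> W) : open U ->
  (forall i, Ck k U (f i)) -> Ck k U (fun x => \sum_(i < m) f i x).
Proof.
move=> oU; elim: m f => [|m IH] f H.
  by apply: Ck_ext (Ck_cst k U 0) => // x _; rewrite big_ord0.
apply: Ck_ext (CkD oU (IH (fun i => f (widen_ord (leqnSn m) i)) _) (H ord_max)) => //.
by move=> x _; rewrite big_ord_recr.
Qed.

Lemma CkM n k U (f g : 'rV[R]_n -> R) : open U ->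
  Ck k U f -> Ck k U g -> Ck k U (fun x => f x * g x).
Proof.
move=> oU; elim: k f g => [|k IH] f g.
  by move=> cf cg x Ux; apply: continuousM; [exact: cf|exact: cg].
move=> Hf Hg; have [df Df] := Hf; have [dg Dg] := Hg; split=> [x Ux|v].
  by apply: differentiableM; [exact: df|exact: dg].
have := CkD oU (IH _ _ (CkS Hf) (Dg v)) (IH _ _ (CkS Hg) (Df v)).
apply: Ck_ext => // x Ux.
by rewrite [RHS]deriveM//; apply: diff_derivable; [exact: df|exact: dg].
Qed.

Lemma Ck_id n k U : Ck k U (@id 'rV[R]_n).
Proof.
case: k => [|k]; first by move=> x _; exact: cvg_id.
split=> [x _|v]; first exact: ex_diff.
suff -> : (fun x => 'D_v (@id 'rV[R]_n) x) = fun=> v by exact: Ck_cst.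
by apply/funext => x; rewrite derive_id.
Qed.

Lemma Ck_coord n m k U (f : 'rV[R]_n -> 'rV[R]_m) i : open U ->
  Ck k U f -> Ck k U (fun x => f x 0 i).
Proof.
move=> oU; elim: k f => [|k IH] f.
  move=> cf x Ux; apply: (@continuous_comp _ _ _ f (fun M => M 0 i)).
    exact: cf.
  exact: coord_continuous.
move=> [df Df]; split=> [x Ux|v].
  apply: (@differentiable_comp _ _ _ _ f (fun M => M 0 i)); first exact: df.
  exact: differentiable_coord.
apply: Ck_ext (IH _ (Df v)) => // x Ux.
by rewrite derive_mx ?mxE//; exact/diff_derivable/df.
Qed.

Lemma Ck_comp n m k (U : set 'rV[R]_n) (V : set 'rV[R]_m)
    (f : 'rV[R]_n -> R) (h : 'rV[R]_m -> 'rV[R]_n) : open V ->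
  (forall x, V x -> U (h x)) -> Ck k U f -> Ck k V h -> Ck k V (f \o h).
Proof.
move=> oV hVU; elim: k f h hVU => [|k IH] f h hVU.
  by move=> cf ch x Vx; apply: continuous_comp; [exact: ch|exact/cf/hVU].
move=> Hf Hh; have [df Df] := Hf; have [dh Dh] := Hh; split=> [x Vx|v].
  by apply: differentiable_comp; [exact: dh|exact/df/hVU].
have := @Ck_sum m R k V n (fun i x => 'D_v h x 0 i * 'D_(delta_mx 0 i) f (h x)) oV.
move=> /(_ _)/Ck_ext; apply => //; last first.
  move=> i; apply: CkM => //; first exact: Ck_coord (Dh v).
  exact: (IH (fun y => 'D_(delta_mx 0 i) f y) h hVU (Df _) (CkS Hh)).
move=> x Vx; have dfx := df _ (hVU _ Vx); have dhx := dh _ Vx.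
have -> : 'D_v (f \o h) x = 'd f (h x) ('D_v h x).
  rewrite (deriveE v (differentiable_comp dhx dfx)) diff_comp //.
  by rewrite (deriveE v dhx).
rewrite [in RHS](row_sum_delta ('D_v h x)) linear_sum /=.
by apply: eq_bigr => i _; rewrite (deriveE _ dfx) linearZ.
Qed.

Lemma Cinfty_cts n (W : normedModType R) U (f : 'rV[R]_n -> W) (V : set W) :
  open U -> Cinfty U f -> open V -> open (U `&` f @^-1` V).
Proof.
move=> oU /(_ 0%N) cf oV; rewrite openE => x [Ux Vfx].
apply: filterI; first exact: open_nbhs_nbhs.
by apply: cf => //; exact: open_nbhs_nbhs.
Qed.

End Calculus.

(* A parametrization U -> T is encoded as a total function together with its
   domain U; plot_ext says that only its values on U matter. *)
HB.mixin Record isDiffeological (R : realType) (T : Type) := {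
  plot : forall n : nat, set 'rV[R]_n -> ('rV[R]_n -> T) -> Prop;
  plot_open : forall n (U : set 'rV[R]_n) (P : 'rV[R]_n -> T),
    plot n U P -> open U;
  plot_ext : forall n (U : set 'rV[R]_n) (P Q : 'rV[R]_n -> T),
    plot n U P -> (forall r, U r -> P r = Q r) -> plot n U Q;
  plot_cst : forall n (U : set 'rV[R]_n) (x : T), open U -> plot n U (fun=> x);
  plot_local : forall n (U : set 'rV[R]_n) (P : 'rV[R]_n -> T), open U ->
    (forall r, U r -> exists V, [/\ V r, V `<=` U & plot n V P]) -> plot n U P;
  plot_comp : forall n m (U : set 'rV[R]_n) (V : set 'rV[R]_m)
      (P : 'rV[R]_n -> T) (h : 'rV[R]_m -> 'rV[R]_n),
    plot n U P -> open V -> Cinfty V h -> (forall s, V s -> U (h s)) ->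
    plot m V (P \o h)
}.

#[short(type="diffeologicalType")]
HB.structure Definition Diffeological (R : realType) :=
  {T of isDiffeological R T}.

Arguments plot {R s n} U P.
Arguments plot_open {R s n U P}.
Arguments plot_ext {R s n U P Q}.
Arguments plot_cst {R s n U} x.
Arguments plot_local {R s n U P}.
Arguments plot_comp {R s n m U V P h}.

Definition smooth (R : realType) (X Y : diffeologicalType R) (f : X -> Y) : Prop :=
  forall n (U : set 'rV[R]_n) (P : 'rV[R]_n -> X), plot U P -> plot U (f \o P).

Definition diffeomorphic (R : realType) (X Y : diffeologicalType R) : Prop :=
  exists (f : X -> Y) (g : Y -> X),
    [/\ smooth f, smooth g, cancel f g & cancel g f].

Section BasicDiffeology.
Context {R : realType}.
Implicit Types X Y Z : diffeologicalType R.

Lemma plot_sub X n (U V : set 'rV[R]_n) (P : 'rV[R]_n -> X) :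
  plot U P -> open V -> V `<=` U -> plot V P.
Proof.
by move=> pP oV VU; apply: (plot_comp pP (h := id)) => // k; exact: Ck_id.
Qed.

Lemma smooth_id X : smooth (@id X). Proof. by []. Qed.

Lemma smooth_cst X Y (y : Y) : smooth (fun _ : X => y).
Proof. by move=> n U P /plot_open; exact: plot_cst. Qed.

Lemma smooth_comp X Y Z (f : X -> Y) (g : Y -> Z) :
  smooth f -> smooth g -> smooth (g \o f).
Proof. by move=> sf sg n U P /sf; exact: sg. Qed.

End BasicDiffeology.

Section Subset.
Context {R : realType} (X : diffeologicalType R) (A : set X).

Definition sub_plot n (U : set 'rV[R]_n) (P : 'rV[R]_n -> A) : Prop :=
  plot U (fun r => \val (P r)).

Let sub_open n U P : @sub_plot n U P -> open U. Proof. exact: plot_open. Qed.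
Let sub_ext n (U : set 'rV[R]_n) (P Q : 'rV[R]_n -> A) :
  sub_plot U P -> (forall r, U r -> P r = Q r) -> sub_plot U Q.
Proof. by move=> pP PQ; apply: plot_ext pP _ => r /PQ ->. Qed.
Let sub_cst n (U : set 'rV[R]_n) (x : A) : open U -> sub_plot U (fun=> x).
Proof. exact: plot_cst. Qed.
Let sub_local n (U : set 'rV[R]_n) (P : 'rV[R]_n -> A) : open U ->
  (forall r, U r -> exists V, [/\ V r, V `<=` U & sub_plot V P]) -> sub_plot U P.
Proof. exact: plot_local. Qed.
Let sub_comp n m (U : set 'rV[R]_n) (V : set 'rV[R]_m)
    (P : 'rV[R]_n -> A) (h : 'rV[R]_m -> 'rV[R]_n) :
  sub_plot U P -> open V -> Cinfty V h -> (forall s, V s -> U (h s)) ->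
  sub_plot V (P \o h).
Proof. exact: plot_comp. Qed.

HB.instance Definition _ := isDiffeological.Build R (set_type A)
  sub_open sub_ext sub_cst sub_local sub_comp.

End Subset.

Section Product.
Context {R : realType} (X Y : diffeologicalType R).

Definition prod_plot n (U : set 'rV[R]_n) (P : 'rV[R]_n -> X * Y) : Prop :=
  plot U (fun r => (P r).1) /\ plot U (fun r => (P r).2).

Let prod_open n U P : @prod_plot n U P -> open U.
Proof. by move=> [/plot_open]. Qed.
Let prod_ext n (U : set 'rV[R]_n) (P Q : 'rV[R]_n -> X * Y) :
  prod_plot U P -> (forall r, U r -> P r = Q r) -> prod_plot U Q.
Proof.
by move=> [p1 p2] PQ; split;
  [apply: plot_ext p1 _|apply: plot_ext p2 _] => r /PQ ->.
Qed.
Let prod_cst n (U : set 'rV[R]_n) (x : X * Y) : open U -> prod_plot U (fun=> x).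
Proof. by split; exact: plot_cst. Qed.
Let prod_local n (U : set 'rV[R]_n) (P : 'rV[R]_n -> X * Y) : open U ->
  (forall r, U r -> exists V, [/\ V r, V `<=` U & prod_plot V P]) ->
  prod_plot U P.
Proof.
by move=> oU H; split; apply: plot_local => // r /H[V [Vr VU [p1 p2]]]; exists V.
Qed.
Let prod_comp n m (U : set 'rV[R]_n) (V : set 'rV[R]_m)
    (P : 'rV[R]_n -> X * Y) (h : 'rV[R]_m -> 'rV[R]_n) :
  prod_plot U P -> open V -> Cinfty V h -> (forall s, V s -> U (h s)) ->
  prod_plot V (P \o h).
Proof.
by move=> [p1 p2] oV ch hVU; split; [exact: plot_comp p1 _ _ _|exact: plot_comp p2 _ _ _].
Qed.

HB.instance Definition _ := isDiffeological.Build R (X * Y)%type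
  prod_open prod_ext prod_cst prod_local prod_comp.

End Product.

Section Quotient.
Context {R : realType} (X : diffeologicalType R) (Q : Type) (proj : X -> Q).

Definition quot_plot n (U : set 'rV[R]_n) (P : 'rV[R]_n -> Q) : Prop :=
  open U /\ forall r, U r -> exists V (L : 'rV[R]_n -> X),
    [/\ V r, V `<=` U, plot V L & forall s, V s -> P s = proj (L s)].

Lemma quot_open n U P : @quot_plot n U P -> open U. Proof. by case. Qed.
Lemma quot_ext n (U : set 'rV[R]_n) (P P' : 'rV[R]_n -> Q) :
  quot_plot U P -> (forall r, U r -> P r = P' r) -> quot_plot U P'.
Proof.
move=> [oU H] E; split=> // r /H[V [L [Vr VU pL PL]]]; exists V, L.
by split=> // s Vs; rewrite -E ?PL//; exact: VU.
Qed.
Lemma quot_cst (surj : forall q, exists x, proj x = q)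
  n (U : set 'rV[R]_n) (q : Q) : open U -> quot_plot U (fun=> q).
Proof.
have [x <-] := surj q; move=> oU; split=> // r Ur; exists U, (fun=> x).
by split=> //; exact: plot_cst.
Qed.
Lemma quot_local n (U : set 'rV[R]_n) (P : 'rV[R]_n -> Q) : open U ->
  (forall r, U r -> exists V, [/\ V r, V `<=` U & quot_plot V P]) ->
  quot_plot U P.
Proof.
move=> oU H; split=> // r /H[V [Vr VU [oV /(_ r Vr)[W [L [Wr WV pL PL]]]]]].
by exists W, L; split=> //; exact: subset_trans WV VU.
Qed.
Lemma quot_comp n m (U : set 'rV[R]_n) (V : set 'rV[R]_m)
    (P : 'rV[R]_n -> Q) (h : 'rV[R]_m -> 'rV[R]_n) :
  quot_plot U P -> open V -> Cinfty V h -> (forall s, V s -> U (h s)) ->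
  quot_plot V (P \o h).
Proof.
move=> [oU H] oV ch hVU; split=> // r Vr.
have [W [L [Wr WU pL PL]]] := H _ (hVU _ Vr).
exists (V `&` h @^-1` W), (L \o h); split=> //; last by move=> s [_ /PL].
apply: (plot_comp pL); last by move=> s [].
  exact: Cinfty_cts oV ch (plot_open pL).
by move=> k; apply: Ck_sub (ch k) => s [].
Qed.

End Quotient.

Section Manifolds.
Context {R : realType} (M : diffeologicalType R).

(* Open sets of the D-topology, which for a manifold is the manifold topology. *)
Definition Dopen (A : set M) : Prop :=
  forall n (U : set 'rV[R]_n) (P : 'rV[R]_n -> M), plot U P ->
    open (U `&` P @^-1` A).

(* c restricts to a diffeomorphism from the open set W of R^n (with the C^oo
   parametrizations as plots) onto a D-open subset of M: the plots of M with
   values in c(W) are exactly the c \o h with h : U -> W of class C^oo. *)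
Definition chart n (W : set 'rV[R]_n) (c : 'rV[R]_n -> M) : Prop :=
  [/\ plot W c,
      forall u v, W u -> W v -> c u = c v -> u = v,
      Dopen (c @` W) &
      forall m (U : set 'rV[R]_m) (P : 'rV[R]_m -> M), plot U P ->
        (forall r, U r -> (c @` W) (P r)) ->
        exists h : 'rV[R]_m -> 'rV[R]_n,
          [/\ Cinfty U h, forall r, U r -> W (h r) &
              forall r, U r -> P r = c (h r)]].

(* Hausdorff and locally Euclidean; the dimension is only required to be locally
   constant, and second countability is not required. *)
Definition is_manifold : Prop :=
  (forall x y : M, x <> y -> exists A B : set M,
     [/\ Dopen A, Dopen B, A x, B y & A `&` B = set0]) /\
  (forall x : M, exists n (W : set 'rV[R]_n) (c : 'rV[R]_n -> M),
     chart W c /\ (c @` W) x).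

Definition Csmooth : set (M -> R) :=
  [set f : M -> R | forall n (U : set 'rV[R]_n) (P : 'rV[R]_n -> M),
             plot U P -> Cinfty U (f \o P)].

(* T_x M as derivations at x of the algebra of smooth functions on M. Partial
   functions are made total by the value 0: a tangent vector vanishes on
   nonsmooth functions, and a covector at x (a linear form on T_x M) vanishes on
   functionals which are not in T_x M, so that equality of vectors, resp.
   covectors, is equality of functions. *)
Definition tangent (x : M) : set ((M -> R) -> R) := [set D : (M -> R) -> R |
  [/\ forall f, ~ Csmooth f -> D f = 0,
      forall (a : R) f g, Csmooth f -> Csmooth g ->
        D (fun y => a * f y + g y) = a * D f + D g &
      forall f g, Csmooth f -> Csmooth g ->
        D (fun y => f y * g y) = f x * D g + D f * g x]].

Definition cotangent (x : M) : set (((M -> R) -> R) -> R) := [set xi : ((M -> R) -> R) -> R |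
  (forall D, ~ tangent x D -> xi D = 0) /\
  (forall (a : R) D E, tangent x D -> tangent x E ->
     xi (fun f => a * D f + E f) = a * xi D + xi E)].

(* The vector c_*(v) at c u; for a chart c and v = e_i this is the coordinate
   vector d/dx_i. *)
Definition velocity n (c : 'rV[R]_n -> M) (u v : 'rV[R]_n) : (M -> R) -> R :=
  fun f => if f \in Csmooth then 'D_v (f \o c) u else 0.

End Manifolds.

Arguments Csmooth {R M}.

Section SmoothFunctions.
Context {R : realType} (M : diffeologicalType R).

Lemma CsmoothD (a : R) (f g : M -> R) : Csmooth f -> Csmooth g ->
  Csmooth (fun y => a * f y + g y).
Proof.
move=> sf sg n U P pP k; have oU := plot_open pP.
apply: CkD => //; last exact: sg.
by apply: CkM => //; [exact: Ck_cst|exact: sf].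
Qed.

Lemma CsmoothM (f g : M -> R) : Csmooth f -> Csmooth g ->
  Csmooth (fun y => f y * g y).
Proof.
move=> sf sg n U P pP k; have oU := plot_open pP.
by apply: CkM => //; [exact: sf|exact: sg].
Qed.

Lemma velocity_tangent n (W : set 'rV[R]_n) (c : 'rV[R]_n -> M) u v :
  plot W c -> W u -> tangent (c u) (velocity c u v).
Proof.
move=> pc Wu.
have df f : Csmooth f -> derivable (f \o c) u v.
  move=> sf; apply: diff_derivable.
  by have [+ _] := sf _ _ _ pc 1%N; exact.
split=> [f nf|a f g sf sg|f g sf sg]; rewrite /velocity.
- by rewrite memNset.
- rewrite !mem_set //; last exact: CsmoothD.
  have E : 'D_v (a *: (f \o c) + (g \o c)) u =
      a *: 'D_v (f \o c) u + 'D_v (g \o c) u.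
    rewrite (deriveD (derivableZ (k := a) (df f sf)) (df g sg)).
    by rewrite (deriveZ a (df f sf)).
  exact: E.
- rewrite !mem_set //; last exact: CsmoothM.
  have E : 'D_v ((f \o c) * (g \o c)) u =
      (f \o c) u *: 'D_v (g \o c) u + (g \o c) u *: 'D_v (f \o c) u.
    exact: deriveM (df f sf) (df g sg).
  by rewrite [X in _ + X]mulrC; exact: E.
Qed.

End SmoothFunctions.

Section Push.
Context {R : realType}.

(* F_* on tangent vectors, and its transpose T^*_{F(x)} N -> T^*_x M. *)
Definition push (M N : diffeologicalType R) (F : M -> N) (D : (M -> R) -> R) :
    (N -> R) -> R :=
  fun f => if f \in Csmooth then D (f \o F) else 0.

Definition copull (M N : diffeologicalType R) (F : M -> N) (x : M)
    (xi : ((N -> R) -> R) -> R) : ((M -> R) -> R) -> R :=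
  fun D => if D \in tangent x then xi (push F D) else 0.

Lemma Csmooth_comp (M N : diffeologicalType R) (F : M -> N) (f : N -> R) :
  smooth F -> Csmooth f -> Csmooth (f \o F).
Proof. by move=> sF sf n U P pP; apply: (sf _ _ (F \o P)); exact: sF. Qed.

Context (M N K : diffeologicalType R).

Lemma push_tangent (F : M -> N) x D :
  smooth F -> tangent x D -> tangent (F x) (push F D).
Proof.
move=> sF [D0 Dl DL]; split=> [f nf|a f g sf sg|f g sf sg]; rewrite /push.
- by rewrite memNset.
- rewrite !mem_set //; last exact: CsmoothD.
  exact: (Dl a (f \o F) (g \o F) (Csmooth_comp sF sf) (Csmooth_comp sF sg)).
- rewrite !mem_set //; last exact: CsmoothM.
  exact: (DL (f \o F) (g \o F) (Csmooth_comp sF sf) (Csmooth_comp sF sg)).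
Qed.

Lemma push_comp (F : M -> N) (G : N -> K) D :
  smooth G -> push G (push F D) = push (G \o F) D.
Proof.
move=> sG; apply/funext => f; rewrite /push; case: ifPn => // /set_mem sf.
by rewrite mem_set //; exact: Csmooth_comp.
Qed.

Lemma push_id x (D : (M -> R) -> R) : tangent x D -> push id D = D.
Proof.
move=> [D0 _ _]; apply/funext => f; rewrite /push; case: ifPn => // nf.
by rewrite D0 // => /mem_set; exact/negP.
Qed.

Lemma push_lin (F : M -> N) (a : R) (D E : (M -> R) -> R) :
  push F (fun f => a * D f + E f) = fun f => a * push F D f + push F E f.
Proof.
by apply/funext => f; rewrite /push; case: ifPn => // _; rewrite mulr0 addr0.
Qed.

Lemma tangent_lin x (a : R) (D E : (M -> R) -> R) :
  tangent x D -> tangent x E -> tangent x (fun f => a * D f + E f).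
Proof.
move=> [D0 Dl DL] [E0 El EL]; split=> [f nf|b f g sf sg|f g sf sg].
- by rewrite D0 // E0 // mulr0 addr0.
- by rewrite Dl // El //; ring.
- by rewrite DL // EL //; ring.
Qed.

Lemma copull_cotangent (F : M -> N) x xi :
  smooth F -> cotangent (F x) xi -> cotangent x (copull F x xi).
Proof.
move=> sF [xi0 xil]; split=> [D nD|a D E tD tE]; rewrite /copull.
  by rewrite memNset.
rewrite !mem_set //; last exact: tangent_lin.
by rewrite push_lin xil //; exact: push_tangent.
Qed.

Lemma copull_eq (F F' : M -> N) x x' xi :
  F =1 F' -> x = x' -> copull F x xi = copull F' x' xi.
Proof. by move=> /funext -> ->. Qed.

Lemma copull_comp (F : M -> N) (G : N -> K) x y xi : smooth F -> smooth G ->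
  y = F x -> copull F x (copull G y xi) = copull (G \o F) x xi.
Proof.
move=> sF sG ->; apply/funext => D; rewrite /copull; case: ifPn => // /set_mem tD.
by rewrite mem_set ?push_comp//; exact: push_tangent.
Qed.

Lemma copull_id x (xi : ((M -> R) -> R) -> R) :
  cotangent x xi -> copull id x xi = xi.
Proof.
move=> [xi0 _]; apply/funext => D; rewrite /copull; case: ifPn => [/set_mem|] tD.
  by rewrite (push_id tD).
by rewrite xi0 // => /mem_set; exact/negP.
Qed.

Lemma copullB (F : M -> N) x (xi eta : ((N -> R) -> R) -> R) :
  copull F x (xi - eta) = copull F x xi - copull F x eta.
Proof.
apply/funext => D; rewrite -[RHS]/(copull F x xi D - copull F x eta D) /copull.
by case: ifPn => // _; rewrite subr0.
Qed.

Lemma cotangentB x (xi eta : ((M -> R) -> R) -> R) :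
  cotangent x xi -> cotangent x eta -> cotangent x (xi - eta).
Proof.
move=> [x0 xl] [e0 el]; split=> [D nD|a D E tD tE].
  by rewrite -[LHS]/(xi D - eta D) x0 // e0 // subr0.
rewrite -[LHS]/(xi (fun f => a * D f + E f) - eta (fun f => a * D f + E f)).
rewrite -[RHS]/(a * (xi D - eta D) + (xi E - eta E)) xl // el //; ring.
Qed.

Lemma cotangent0 x : cotangent x (0 : ((M -> R) -> R) -> R).
Proof. by split=> // a D E _ _; rewrite mulr0 addr0. Qed.

End Push.

Section CotangentBundle.
Context {R : realType} (M : diffeologicalType R).

Record cotangent_bundle := CotangentBundle {
  base : M;
  covector : ((M -> R) -> R) -> R;
  covectorP : cotangent base covector
}.

Lemma cotangent_bundle_eq (p q : cotangent_bundle) :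
  base p = base q -> covector p = covector q -> p = q.
Proof.
case: p q => [x xi Hp] [y eta Hq] /= exy exi; subst.
by congr CotangentBundle; exact: Prop_irrelevance.
Qed.

(* The manifold diffeology of T^*M, given by its usual coordinates (q, p): the
   base point is a plot and, over the domain of each chart c of M, with u(r) the
   coordinates of the base point of P(r), the components p_i are C^oo. *)
Definition cot_plot n (U : set 'rV[R]_n) (P : 'rV[R]_n -> cotangent_bundle) :
    Prop :=
  plot U (base \o P) /\
  forall d (W : set 'rV[R]_d) (c : 'rV[R]_d -> M), chart W c ->
  forall (V : set 'rV[R]_n) (u : 'rV[R]_n -> 'rV[R]_d),
    open V -> V `<=` U -> Cinfty V u ->
    (forall r, V r -> W (u r)) -> (forall r, V r -> base (P r) = c (u r)) ->
  forall i, Cinfty V (fun r => covector (P r) (velocity c (u r) (delta_mx 0 i))).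

Let cot_open n U P : @cot_plot n U P -> open U.
Proof. by move=> [/plot_open]. Qed.

Let cot_ext n (U : set 'rV[R]_n) (P Q : 'rV[R]_n -> cotangent_bundle) :
  cot_plot U P -> (forall r, U r -> P r = Q r) -> cot_plot U Q.
Proof.
move=> [pP cP] PQ; split; first by apply: plot_ext pP _ => r /PQ /= ->.
move=> d W c chc V u oV VU cu uW E i k.
have E' r : V r -> base (P r) = c (u r) by move=> Vr; rewrite PQ ?E//; exact: VU.
apply: Ck_ext (cP _ _ _ chc V u oV VU cu uW E' i k) => // r /VU Ur.
by rewrite PQ.
Qed.

Let cot_cst n (U : set 'rV[R]_n) (x : cotangent_bundle) :
  open U -> cot_plot U (fun=> x).
Proof.
move=> oU; split; first exact: plot_cst.
move=> d W c [_ injc _ _] V u oV VU cu uW E i k.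
have [[r Vr]|nV] := pselect (exists r, V r); last first.
  by apply: Ck_local => r Vr; case: nV; exists r.
apply: Ck_ext (Ck_cst k V (covector x (velocity c (u r) (delta_mx 0 i)))) => // s Vs.
suff -> : u s = u r by [].
by apply: injc; [exact: uW|exact: uW|rewrite -(E s Vs) -(E r Vr)].
Qed.

Let cot_local n (U : set 'rV[R]_n) (P : 'rV[R]_n -> cotangent_bundle) : open U ->
  (forall r, U r -> exists V, [/\ V r, V `<=` U & cot_plot V P]) -> cot_plot U P.
Proof.
move=> oU H; split.
  by apply: plot_local => // r /H[V [Vr VU [pV _]]]; exists V.
move=> d W c chc V u oV VU cu uW E i k; apply: Ck_local => r Vr.
have [V' [V'r V'U [pV' cV']]] := H r (VU _ Vr).
exists (V `&` V') => //.
apply: (cV' _ _ _ chc (V `&` V') u).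
- exact: openI oV (plot_open pV').
- by move=> s [].
- by move=> k'; apply: Ck_sub (cu k') => s [].
- by move=> s [/uW].
- by move=> s [/E].
Qed.

Let cot_comp n m (U : set 'rV[R]_n) (V : set 'rV[R]_m)
    (P : 'rV[R]_n -> cotangent_bundle) (h : 'rV[R]_m -> 'rV[R]_n) :
  cot_plot U P -> open V -> Cinfty V h -> (forall s, V s -> U (h s)) ->
  cot_plot V (P \o h).
Proof.
move=> [pP cP] oV ch hVU; split; first exact: (plot_comp pP).
move=> d W c chc V' u oV' V'V cu uW E i k.
have [pc injc oc lc] := chc.
have oU' : open (U `&` (base \o P) @^-1` (c @` W)) := oc _ _ _ pP.
set U' := _ `&` _ in oU'.
have pU' : plot U' (base \o P) by apply: (plot_sub pP) => // r [].
have [w [cw wW Ew]] := lc _ _ _ pU' (fun r (H : U' r) => H.2).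
have hU' s : V' s -> U' (h s).
  move=> V's; split; first by apply/hVU/V'V.
  by rewrite /=; exists (u s); [exact: uW|rewrite -(E s V's)].
have wE s : V' s -> w (h s) = u s.
  move=> V's; apply: injc; [exact/wW/hU'|exact: uW|].
  by rewrite -(E s V's) -(Ew _ (hU' _ V's)).
have U'U : U' `<=` U by move=> r [].
have cov := cP _ _ _ chc U' w oU' U'U cw wW Ew i k.
have ch' : Ck k V' h by exact: Ck_sub V'V (ch k).
apply: Ck_ext (Ck_comp oV' hU' cov ch') => // s V's.
by rewrite /= wE.
Qed.

HB.instance Definition _ := isDiffeological.Build R cotangent_bundle
  cot_open cot_ext cot_cst cot_local cot_comp.

End CotangentBundle.

HB.mixin Record isDiffeologicalGroup (R : realType) G
    of Group G & Diffeological R G := {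
  mulg_smooth : smooth (fun p : G * G => (p.1 * p.2)%g);
  invg_smooth : smooth (fun g : G => (g^-1)%g)
}.

#[short(type="diffeologicalGroupType")]
HB.structure Definition DiffeologicalGroup (R : realType) :=
  {G of Group G & Diffeological R G & isDiffeologicalGroup R G}.

HB.mixin Record isManifold (R : realType) M of Diffeological R M := {
  manifoldP : is_manifold M
}.

#[short(type="lieGroupType")]
HB.structure Definition LieGroup (R : realType) :=
  {G of DiffeologicalGroup R G & isManifold R G}.

Section Subgroup.
Context {R : realType} (G : diffeologicalGroupType R).

Record closedSubgroup := ClosedSubgroup {
  subgroup_set :> set G;
  subgroup1 : subgroup_set 1%g;
  subgroupM : forall g h, subgroup_set g -> subgroup_set h -> subgroup_set (g * h)%g;
  subgroupV : forall g, subgroup_set g -> subgroup_set (g^-1)%g;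
  subgroup_closed : Dopen (~` subgroup_set)
}.

Context (H : closedSubgroup).

(* H as a group in its own right, with the subset diffeology; since H is closed,
   it is the manifold diffeology of the embedded Lie subgroup H. *)
Definition subgroup_type : Type := set_type H.

HB.instance Definition _ := Choice.on subgroup_type.
HB.instance Definition _ := Diffeological.copy subgroup_type (set_type H).

Let sone : subgroup_type := exist (fun g : G => g \in (H : set G)) _ (mem_set (subgroup1 H)).
Let sinv (g : subgroup_type) : subgroup_type :=
  exist (fun g : G => g \in (H : set G)) _ (mem_set (subgroupV (set_mem (valP g)))).
Let smul (g h : subgroup_type) : subgroup_type :=
  exist (fun g : G => g \in (H : set G)) _ (mem_set (subgroupM (set_mem (valP g)) (set_mem (valP h)))).

Let smulA : associative smul.
Proof. by move=> x y z; apply: val_inj; rewrite /= mulgA. Qed.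
Let smul1 : left_id sone smul.
Proof. by move=> x; apply: val_inj; rewrite /= mul1g. Qed.
Let s1mul : right_id sone smul.
Proof. by move=> x; apply: val_inj; rewrite /= mulg1. Qed.
Let smulV : left_inverse sone sinv smul.
Proof. by move=> x; apply: val_inj; rewrite /= mulVg. Qed.
Let sVmul : right_inverse sone sinv smul.
Proof. by move=> x; apply: val_inj; rewrite /= mulgV. Qed.

HB.instance Definition _ := isGroup.Build subgroup_type smulA smul1 s1mul smulV sVmul.

Let smul_smooth : smooth (fun p : subgroup_type * subgroup_type => (p.1 * p.2)%g).
Proof.
move=> n U P [p1 p2].
exact: (@mulg_smooth R G n U (fun r => (val (P r).1, val (P r).2)) (conj p1 p2)).
Qed.
Let sinv_smooth : smooth (fun g : subgroup_type => (g^-1)%g).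
Proof. by move=> n U P pP; exact: (@invg_smooth R G n U (fun r => val (P r)) pP). Qed.

HB.instance Definition _ :=
  isDiffeologicalGroup.Build R subgroup_type smul_smooth sinv_smooth.

Definition subgroup_incl (h : subgroup_type) : G := \val h.

End Subgroup.

Section Translations.
Context {R : realType} (G : diffeologicalGroupType R).
Implicit Types g h : G.

Lemma smooth_mulg (X : diffeologicalType R) (a b : X -> G) :
  smooth a -> smooth b -> smooth (fun x => (a x * b x)%g).
Proof.
move=> sa sb n U P pP.
exact: (@mulg_smooth R G n U (fun r => (a (P r), b (P r)))
  (conj (sa _ _ _ pP) (sb _ _ _ pP))).
Qed.

Lemma smooth_mulgl g : smooth (fun x : G => (g * x)%g).
Proof. by apply: smooth_mulg; [exact: smooth_cst|exact: smooth_id]. Qed.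

Lemma smooth_mulgr g : smooth (fun x : G => (x * g)%g).
Proof. by apply: smooth_mulg; [exact: smooth_id|exact: smooth_cst]. Qed.

(* The lifted translations g p and p g, for p a covector at q = base p:
   <gp, v> = <p, g^-1 v> for v in T_{gq} G and <pg, v> = <p, v g^-1> for v in
   T_{qg} G. *)
Lemma ltrans_subproof g (p : cotangent_bundle G) :
  cotangent (g * base p)%g
    (copull (fun x : G => (g^-1 * x)%g) (g * base p)%g (covector p)).
Proof.
apply: copull_cotangent; first exact: smooth_mulgl.
by rewrite mulKg; exact: covectorP.
Qed.

Definition ltrans g (p : cotangent_bundle G) : cotangent_bundle G :=
  CotangentBundle (ltrans_subproof g p).

Lemma rtrans_subproof g (p : cotangent_bundle G) :
  cotangent (base p * g)%g
    (copull (fun x : G => (x * g^-1)%g) (base p * g)%g (covector p)).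
Proof.
apply: copull_cotangent; first exact: smooth_mulgr.
by rewrite mulgK; exact: covectorP.
Qed.

Definition rtrans (p : cotangent_bundle G) g : cotangent_bundle G :=
  CotangentBundle (rtrans_subproof g p).

(* The coadjoint action <g mu g^-1, Z> = <mu, g^-1 Z g> on the dual of the Lie
   algebra T_1 G. *)
Definition coAd g (mu : ((G -> R) -> R) -> R) : ((G -> R) -> R) -> R :=
  copull (fun x : G => (g^-1 * x * g)%g) 1%g mu.

Lemma smooth_conjg g : smooth (fun x : G => (g^-1 * x * g)%g).
Proof. exact: (smooth_comp (smooth_mulgl g^-1%g) (smooth_mulgr g)). Qed.

Lemma coAd_cotangent g mu : cotangent 1%g mu -> cotangent 1%g (coAd g mu).
Proof.
move=> Hmu; apply: copull_cotangent; first exact: smooth_conjg.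
by rewrite mulg1 mulVg.
Qed.

Lemma coAd0 g : coAd g 0 = 0.
Proof. by apply/funext => D; rewrite /coAd /copull; case: ifPn. Qed.

Lemma coAdD g mu nu : coAd g (mu + nu) = coAd g mu + coAd g nu.
Proof.
apply/funext => D; rewrite -[RHS]/(coAd g mu D + coAd g nu D) /coAd /copull.
by case: ifPn => // _; rewrite addr0.
Qed.

Lemma coAdN g mu : coAd g (- mu) = - coAd g mu.
Proof.
apply/funext => D; rewrite -[RHS]/(- coAd g mu D) /coAd /copull.
by case: ifPn => // _; rewrite oppr0.
Qed.

(* p q^-1 and q^-1 p for p a covector at q. *)
Definition left_momentum (p : cotangent_bundle G) : ((G -> R) -> R) -> R :=
  covector (rtrans p (base p)^-1%g).

Definition right_momentum (p : cotangent_bundle G) : ((G -> R) -> R) -> R :=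
  covector (ltrans (base p)^-1%g p).

Lemma left_momentumE p :
  left_momentum p = copull (fun x : G => (x * base p)%g) 1%g (covector p).
Proof. by rewrite /left_momentum /= invgK mulgV. Qed.

Lemma right_momentumE p :
  right_momentum p = copull (fun x : G => (base p * x)%g) 1%g (covector p).
Proof. by rewrite /right_momentum /= invgK mulVg. Qed.

Lemma left_momentum_cotangent p : cotangent 1%g (left_momentum p).
Proof.
have -> : 1%g = base (rtrans p (base p)^-1%g) by rewrite /= mulgV.
exact: covectorP.
Qed.

Lemma right_momentum_cotangent p : cotangent 1%g (right_momentum p).
Proof.
have -> : 1%g = base (ltrans (base p)^-1%g p) by rewrite /= mulVg.
exact: covectorP.
Qed.

Lemma ltrans1 p : ltrans 1%g p = p.
Proof.
apply: cotangent_bundle_eq; rewrite /= mul1g // invg1.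
rewrite (_ : (fun x : G => _) = id); first exact/copull_id/covectorP.
by apply/funext => x; rewrite mul1g.
Qed.

Lemma rtrans1 p : rtrans p 1%g = p.
Proof.
apply: cotangent_bundle_eq; rewrite /= mulg1 // invg1.
rewrite (_ : (fun x : G => _) = id); first exact/copull_id/covectorP.
by apply/funext => x; rewrite mulg1.
Qed.

Lemma ltransM g h p : ltrans (g * h)%g p = ltrans g (ltrans h p).
Proof.
apply: cotangent_bundle_eq; rewrite /= ?mulgA //.
rewrite (copull_comp _ (smooth_mulgl _) (smooth_mulgl _)); last first.
  by rewrite !mulgA mulVg mul1g.
by apply: copull_eq => [x|] //; rewrite /= ?invgM ?mulgA.
Qed.

Lemma rtransM g h p : rtrans p (g * h)%g = rtrans (rtrans p g) h.
Proof.
apply: cotangent_bundle_eq; rewrite /= ?mulgA //.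
rewrite (copull_comp _ (smooth_mulgr _) (smooth_mulgr _)); last first.
  by rewrite -!mulgA mulgV mulg1.
by apply: copull_eq => [x|] //; rewrite /= ?invgM ?mulgA.
Qed.

Lemma lrtrans g h p : ltrans g (rtrans p h) = rtrans (ltrans g p) h.
Proof.
apply: cotangent_bundle_eq; rewrite /= ?mulgA //.
rewrite (copull_comp _ (smooth_mulgl _) (smooth_mulgr _)); last first.
  by rewrite !mulgA mulVg mul1g.
rewrite (copull_comp _ (smooth_mulgr _) (smooth_mulgl _)); last first.
  by rewrite -!mulgA mulgV mulg1.
by apply: copull_eq => [x|] //; rewrite /= ?mulgA.
Qed.

Lemma left_momentum_ltrans g p :
  left_momentum (ltrans g p) = coAd g (left_momentum p).
Proof.
rewrite !left_momentumE /coAd /=.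
rewrite (copull_comp _ (smooth_mulgr _) (smooth_mulgl _)); last by rewrite mul1g.
rewrite (copull_comp _ (smooth_conjg _) (smooth_mulgr _)); last first.
  by rewrite mulg1 mulVg.
by apply: copull_eq => [x|] //; rewrite /= ?mulgA.
Qed.

Lemma left_momentum_rtrans g p : left_momentum (rtrans p g) = left_momentum p.
Proof.
rewrite !left_momentumE /=.
rewrite (copull_comp _ (smooth_mulgr _) (smooth_mulgr _)); last by rewrite mul1g.
by apply: copull_eq => [x|] //; rewrite /= mulgA mulgK.
Qed.

Lemma right_momentum_ltrans g p : right_momentum (ltrans g p) = right_momentum p.
Proof.
rewrite !right_momentumE /=.
rewrite (copull_comp _ (smooth_mulgl _) (smooth_mulgl _)); last by rewrite mulg1.
by apply: copull_eq => [x|] //; rewrite /= -mulgA mulKg.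
Qed.

Lemma right_momentum_rtrans g p :
  right_momentum (rtrans p g^-1%g) = coAd g (right_momentum p).
Proof.
rewrite !right_momentumE /coAd /=.
rewrite (copull_comp _ (smooth_mulgl _) (smooth_mulgr _)); last by rewrite mulg1.
rewrite (copull_comp _ (smooth_conjg _) (smooth_mulgl _)); last first.
  by rewrite mulg1 mulVg.
by apply: copull_eq => [x|] //; rewrite /= invgK !mulgA.
Qed.

End Translations.

Section HamiltonianSpaces.
Context {R : realType}.

(* What remains of a Hamiltonian G-space when the smoothness conditions and the
   2-form are forgotten: a diffeological space with a G-action and an equivariant
   map to the dual of T_1 G. The constructions below (opposite, product,
   restriction, reduction, induction) are made at this level because the
   reduced space depends on nothing else. *)
Record momentSpace (G : diffeologicalGroupType R) := MomentSpace {
  ms_sort :> diffeologicalType R;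
  act : G -> ms_sort -> ms_sort;
  moment : ms_sort -> ((G -> R) -> R) -> R;
  act1 : forall x, act 1%g x = x;
  actM : forall g h x, act (g * h)%g x = act g (act h x);
  moment_cotangent : forall x, cotangent 1%g (moment x);
  moment_equivariant : forall g x, moment (act g x) = coAd g (moment x)
}.

Definition form_coord (M : diffeologicalType R)
    (om : M -> ((M -> R) -> R) -> ((M -> R) -> R) -> R)
    n (c : 'rV[R]_n -> M) (i j : 'I_n) (u : 'rV[R]_n) : R :=
  om (c u) (velocity c u (delta_mx 0 i)) (velocity c u (delta_mx 0 j)).

(* om x is a 2-form on T_x M; its values off T_x M are irrelevant. *)
Record is_symplectic (M : diffeologicalType R)
    (om : M -> ((M -> R) -> R) -> ((M -> R) -> R) -> R) : Prop := IsSymplectic {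
  symp_linear : forall x (a : R) D D' E,
    tangent x D -> tangent x D' -> tangent x E ->
    om x (fun f => a * D f + D' f) E = a * om x D E + om x D' E;
  symp_antisym : forall x D E, tangent x D -> tangent x E ->
    om x D E = - om x E D;
  symp_smooth : forall n (W : set 'rV[R]_n) (c : 'rV[R]_n -> M), chart W c ->
    forall i j, Cinfty W (form_coord om c i j);
  symp_closed : forall n (W : set 'rV[R]_n) (c : 'rV[R]_n -> M), chart W c ->
    forall i j k u, W u ->
      'D_(delta_mx 0 i) (form_coord om c j k) u +
      'D_(delta_mx 0 j) (form_coord om c k i) u +
      'D_(delta_mx 0 k) (form_coord om c i j) u = 0;
  symp_nondegenerate : forall x D, tangent x D ->
    (forall E, tangent x E -> om x D E = 0) -> D = 0
}.

(* The vector push (fun g => act g x) Z is the infinitesimal action Z_X at x, and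
   D (fun y => moment y Z) is the value of d<Phi, Z> on D. *)
Record is_hamiltonian (G : diffeologicalGroupType R) (X : momentSpace G)
    (om : X -> ((X -> R) -> R) -> ((X -> R) -> R) -> R) : Prop := IsHamiltonian {
  ham_manifold : is_manifold X;
  ham_symplectic : is_symplectic om;
  ham_act_smooth : smooth (fun gx : G * X => act gx.1 gx.2);
  ham_act_symp : forall g x D E, tangent x D -> tangent x E ->
    om (act g x) (push (act g) D) (push (act g) E) = om x D E;
  ham_moment_smooth : forall Z, tangent (1%g : G) Z ->
    Csmooth (fun x : X => moment x Z);
  ham_momentP : forall Z x D, tangent (1%g : G) Z -> tangent x D ->
    om x (push (fun g : G => act g x) Z) D = - D (fun y : X => moment y Z)
}.

Record hamiltonianSpace (G : diffeologicalGroupType R) := HamiltonianSpace {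
  ham_space :> momentSpace G;
  ham_form : ham_space -> ((ham_space -> R) -> R) -> ((ham_space -> R) -> R) -> R;
  ham_formP : is_hamiltonian ham_form
}.

End HamiltonianSpaces.

Section Operations.
Context {R : realType} (G : diffeologicalGroupType R).

Lemma opp_cotangent (X : momentSpace G) (x : X) : cotangent 1%g (- moment x).
Proof.
by rewrite -sub0r; apply: cotangentB; [exact: cotangent0|exact: moment_cotangent].
Qed.

Lemma opp_equivariant (X : momentSpace G) g (x : X) :
  - moment (act g x) = coAd g (- moment x).
Proof. by rewrite coAdN moment_equivariant. Qed.

Definition opp_ms (X : momentSpace G) : momentSpace G :=
  @MomentSpace R G X (@act _ _ X) (fun x => - moment x)
    (@act1 _ _ X) (@actM _ _ X) (@opp_cotangent X) (@opp_equivariant X).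

Context (X Y : momentSpace G).

Let pact (g : G) (z : X * Y) : X * Y := (act g z.1, act g z.2).
Let pmoment (z : X * Y) := moment z.1 + moment z.2.

Let pact1 z : pact 1%g z = z.
Proof. by case: z => x y; rewrite /pact !act1. Qed.
Let pactM g h z : pact (g * h)%g z = pact g (pact h z).
Proof. by rewrite /pact !actM. Qed.
Let pmoment_cotangent z : cotangent 1%g (pmoment z).
Proof.
rewrite /pmoment -[X in _ + X]opprK; apply: cotangentB.
  exact: moment_cotangent.
exact: opp_cotangent.
Qed.
Let pmoment_equivariant g z : pmoment (pact g z) = coAd g (pmoment z).
Proof. by rewrite /pmoment coAdD !moment_equivariant. Qed.

Definition prod_ms : momentSpace G :=
  @MomentSpace R G (X * Y)%type pact pmoment
    pact1 pactM pmoment_cotangent pmoment_equivariant.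

End Operations.

Section Restriction.
Context {R : realType} (G : diffeologicalGroupType R) (H : closedSubgroup G).
Local Notation HT := (subgroup_type H).
Local Notation incl := (@subgroup_incl R G H).

(* Restriction of linear forms on T_1 G to T_1 H, via T_1 H -> T_1 G. *)
Definition restr (mu : ((G -> R) -> R) -> R) : ((HT -> R) -> R) -> R :=
  copull incl 1%g mu.

Lemma smooth_incl : smooth incl. Proof. by []. Qed.

Lemma restr_cotangent mu : cotangent 1%g mu -> cotangent 1%g (restr mu).
Proof. by move=> Hmu; apply: copull_cotangent; first exact: smooth_incl. Qed.

Lemma restr_coAd h mu : restr (coAd (incl h) mu) = coAd h (restr mu).
Proof.
rewrite /restr /coAd.
rewrite (copull_comp _ smooth_incl (smooth_conjg _)) //.
rewrite (copull_comp _ (smooth_conjg _) smooth_incl) //.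
by rewrite mulg1 mulVg.
Qed.

Context (X : momentSpace G).

Let ract (h : HT) (x : X) : X := act (incl h) x.
Let rmoment (x : X) := restr (moment x).
Let ract1 x : ract 1%g x = x. Proof. exact: act1. Qed.
Let ractM g h x : ract (g * h)%g x = ract g (ract h x). Proof. exact: actM. Qed.
Let rmoment_cotangent x : cotangent 1%g (rmoment x).
Proof. exact/restr_cotangent/moment_cotangent. Qed.
Let rmoment_equivariant h x : rmoment (ract h x) = coAd h (rmoment x).
Proof. by rewrite /rmoment moment_equivariant restr_coAd. Qed.

Definition Res : momentSpace HT :=
  @MomentSpace R HT X ract rmoment
    ract1 ractM rmoment_cotangent rmoment_equivariant.

End Restriction.

Arguments restr {R G} H mu.
Arguments Res {R G} H X.

Section Reduction.
Context {R : realType} (G : diffeologicalGroupType R) (X : momentSpace G).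

Definition orbit (x : X) : set X := range (fun g : G => act g x).

Definition zero_level : set X := [set x | moment x = 0].

(* The orbits in X of the points of the zero level, i.e. the orbit space of
   the zero level, with its quotient diffeology (below). *)
Definition reduction : Type :=
  {A : set X | exists2 x, zero_level x & A = orbit x}.

Definition red_proj (x : zero_level) : reduction :=
  exist _ (orbit (\val x)) (ex_intro2 _ _ (\val x) (set_mem (valP x)) erefl).

Lemma red_eq (a b : reduction) : sval a = sval b -> a = b.
Proof. by case: a b => [A pA] [B pB] /= AB; exact: eq_exist. Qed.

Lemma red_proj_surj (a : reduction) : exists x, red_proj x = a.
Proof.
case: a => A [x x0 eA].
exists (exist (fun x => x \in zero_level) x (mem_set x0)).
by apply: red_eq; rewrite /= eA.
Qed.

Lemma orbit_act g x : orbit (act g x) = orbit x.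
Proof.
apply/seteqP; split=> [_ [h _ <-]|_ [h _ <-]]; rewrite /orbit /=.
  by exists (h * g)%g; rewrite ?actM.
by exists (h * g^-1)%g => //; rewrite -actM mulgVK.
Qed.

Lemma orbitP x y : orbit x = orbit y <-> exists g, y = act g x.
Proof.
split=> [E|[g ->]]; last by rewrite orbit_act.
have : orbit y y by exists 1%g => //; exact: act1.
by rewrite -E => -[g _ <-]; exists g.
Qed.

HB.instance Definition _ := isDiffeological.Build R reduction
  (@quot_open _ _ _ red_proj) (@quot_ext _ _ _ red_proj)
  (quot_cst red_proj_surj) (@quot_local _ _ _ red_proj)
  (@quot_comp _ _ _ red_proj).

End Reduction.

Arguments zero_level {R G} X _.

Section Induction.
Context {R : realType} (G : diffeologicalGroupType R) (H : closedSubgroup G).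
Local Notation HT := (subgroup_type H).
Local Notation incl := (@subgroup_incl R G H).
Context (Y : momentSpace HT).

Let nact (h : HT) (z : cotangent_bundle G * Y) : cotangent_bundle G * Y :=
  (rtrans z.1 (incl h)^-1%g, act h z.2).
Let nmoment (z : cotangent_bundle G * Y) :=
  moment z.2 - restr H (right_momentum z.1).

Let nact1 z : nact 1%g z = z.
Proof. by case: z => p y; rewrite /nact /= invg1 rtrans1 act1. Qed.
Let nactM g h z : nact (g * h)%g z = nact g (nact h z).
Proof. by rewrite /nact /= invgM rtransM actM. Qed.
Let nmoment_cotangent z : cotangent 1%g (nmoment z).
Proof.
apply: cotangentB; first exact: moment_cotangent.
exact/restr_cotangent/right_momentum_cotangent.
Qed.
Let nmoment_equivariant h z : nmoment (nact h z) = coAd h (nmoment z).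
Proof.
rewrite /nmoment /= moment_equivariant right_momentum_rtrans restr_coAd.
by rewrite coAdD coAdN.
Qed.

(* N = T^*G x Y with its H-action and moment map psi. *)
Definition ind_total : momentSpace HT :=
  @MomentSpace R HT (cotangent_bundle G * Y)%type nact nmoment
    nact1 nactM nmoment_cotangent nmoment_equivariant.

Let gact (g : G) (z : ind_total) : ind_total := (ltrans g z.1, z.2).

Lemma ind_act_subproof g (a : reduction ind_total) :
  exists2 z : ind_total, zero_level ind_total z & gact g @` sval a = orbit z.
Proof.
case: a => _ /= [z z0 ->]; exists (gact g z).
  by rewrite /zero_level /= /nmoment /= right_momentum_ltrans.
apply/seteqP; split=> [_ [_ [h _ <-] <-]|_ [h _ <-]].
  by exists h => //=; rewrite /nact /gact /= lrtrans.
exists (nact h z); first by exists h.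
by rewrite /gact /= lrtrans.
Qed.

(* The residual G-action: the image of an H-orbit by (p, y) |-> (g p, y). *)
Definition ind_act (g : G) (a : reduction ind_total) : reduction ind_total :=
  exist _ (gact g @` sval a) (ind_act_subproof g a).

(* The map induced by phi(p, y) = p q^-1, computed on a chosen representative;
   see ind_momentE. *)
Definition ind_moment (a : reduction ind_total) : ((G -> R) -> R) -> R :=
  left_momentum (s2val (cid2 (proj2_sig a))).1.

Lemma ind_momentE (z : zero_level ind_total) :
  ind_moment (red_proj z) = left_momentum (val z).1.
Proof.
rewrite /ind_moment; case: cid2 => z' /= _ E.
have /orbitP[h ->] : orbit (val z) = orbit z' := E.
by rewrite /= left_momentum_rtrans.
Qed.

Let ind_act1 a : ind_act 1%g a = a.
Proof.
apply: red_eq => /=; rewrite [X in X @` _](_ : _ = id) ?image_id//.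
by apply/funext => -[p y]; rewrite /gact /= ltrans1.
Qed.
Let ind_actM g h a : ind_act (g * h)%g a = ind_act g (ind_act h a).
Proof.
apply: red_eq => /=; rewrite image_comp; congr (_ @` _).
by apply/funext => -[p y]; rewrite /gact /= ltransM.
Qed.
Let ind_moment_cotangent a : cotangent 1%g (ind_moment a).
Proof. exact: left_momentum_cotangent. Qed.
Let ind_moment_equivariant g a : ind_moment (ind_act g a) = coAd g (ind_moment a).
Proof.
have [z <-] := red_proj_surj a.
have gz0 : gact g (val z) \in zero_level ind_total.
  apply: mem_set; rewrite /zero_level /= /nmoment /= right_momentum_ltrans.
  exact: (set_mem (valP z)).
have -> : ind_act g (red_proj z) = red_proj (exist (fun w => w \in zero_level ind_total) _ gz0).
  apply: red_eq => /=; apply/seteqP; split=> [_ [_ [h _ <-] <-]|_ [h _ <-]].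
    by exists h => //=; rewrite /nact /gact /= lrtrans.
  by exists (nact h (val z)); [exists h|rewrite /gact /= lrtrans].
by rewrite !ind_momentE /= left_momentum_ltrans.
Qed.

Definition Ind : momentSpace G :=
  @MomentSpace R G (reduction ind_total) ind_act ind_moment
    ind_act1 ind_actM ind_moment_cotangent ind_moment_equivariant.

End Induction.

Definition intertwiner_space (R : realType) (G : diffeologicalGroupType R)
    (X1 X2 : momentSpace G) : diffeologicalType R :=
  reduction (prod_ms (opp_ms X1) X2).

Arguments Ind {R G H} Y.

(* Main.v *)
(** Both sides are quotients of simpler spaces: the left one of the set Z of
    triples (x, p, y) in X x T^*G x Y, p at q, with p q^-1 = Phi(x) and
    Psi(y) = q^-1 p on h, and the right one of the set of pairs (x, y) with
    Psi(y) = Phi(x) on h. The maps (x, p, y) |-> (q^-1 x, y) and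
    (x, y) |-> (x, Phi(x) at 1, y) are smooth, descend to the quotients and are
    mutually inverse there, since (x, p, y) is the translate by q of
    (q^-1 x, q^-1 p, y) and q^-1 p = Phi(q^-1 x) by equivariance. As both
    projections lift plots locally, the induced maps are smooth. *)

From mathcomp Require Import all_boot all_algebra.
From mathcomp Require Import boolp classical_sets functions reals topology normedtype.
Require Import Defs.
Set Implicit Arguments.
Unset Strict Implicit.
Unset Printing Implicit Defensive.
Import GRing.Theory.
Local Open Scope classical_set_scope.
Local Open Scope ring_scope.

Section Subductions.
Context {R : realType}.

Definition subduction (Z Q : diffeologicalType R) (pi : Z -> Q) : Prop :=
  smooth pi /\
  forall n (U : set 'rV[R]_n) (P : 'rV[R]_n -> Q), plot U P ->
  forall r, U r -> exists V (L : 'rV[R]_n -> Z),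
    [/\ V r, V `<=` U, plot V L & forall s, V s -> P s = pi (L s)].

Lemma subduction_comp (Z Q K : diffeologicalType R) (pi : Z -> Q) (rho : Q -> K) :
  subduction pi -> subduction rho -> subduction (rho \o pi).
Proof.
move=> [spi lpi] [srho lrho]; split; first exact: smooth_comp spi srho.
move=> n U P pP r Ur; have [V [L [Vr VU pL PL]]] := lrho n U P pP r Ur.
have [W [M [Wr WV pM LM]]] := lpi n V L pL r Vr.
exists W, M; split=> //; first exact: subset_trans WV VU.
by move=> s Ws; rewrite (PL _ (WV _ Ws)) (LM _ Ws).
Qed.

(** A constant plot on the one-point space R^0 lifts, and the lift evaluated at 0 is a preimage. *)
Lemma subduction_surj (Z Q : diffeologicalType R) (pi : Z -> Q) (q : Q) :
  subduction pi -> exists z, pi z = q.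
Proof.
move=> [_ lpi].
have pq : plot [set: 'rV[R]_0] (fun=> q) := plot_cst q openT.
have [V [L [V0 _ _ E]]] := lpi _ _ _ pq 0 I.
by exists (L 0); rewrite -E.
Qed.

(** Compose [F] with a set-theoretic section [s] of [pi]. No regularity of [s] is involved: over a
    local lift [L] of a plot, the composite equals [F \o L]. *)
Lemma subduction_descent (Z Q K : diffeologicalType R) (pi : Z -> Q) (F : Z -> K) :
  subduction pi -> smooth F -> (forall z w, pi z = pi w -> F z = F w) ->
  exists f : Q -> K, smooth f /\ forall z, f (pi z) = F z.
Proof.
move=> Spi sF FE; have [s sK] := choice (fun q => subduction_surj q Spi).
have fE z : F (s (pi z)) = F z by apply: FE.
exists (F \o s); split=> // n U P pP; apply: plot_local (plot_open pP) _ => r Ur.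
have [V [L [Vr VU pL PL]]] := Spi.2 n U P pP r Ur.
exists V; split=> //; apply: plot_ext (sF _ _ _ pL) _ => t Vt.
by rewrite /= (PL _ Vt) fE.
Qed.

(** The maps [k1] and [k2] are mutually inverse only up to the fibres of the projections, which is
    enough for the descended maps. *)
Lemma subduction_diffeomorphic (Z1 Z2 Q1 Q2 : diffeologicalType R)
    (pi1 : Z1 -> Q1) (pi2 : Z2 -> Q2) (k1 : Z1 -> Z2) (k2 : Z2 -> Z1) :
  subduction pi1 -> subduction pi2 -> smooth k1 -> smooth k2 ->
  (forall z w, pi1 z = pi1 w -> pi2 (k1 z) = pi2 (k1 w)) ->
  (forall z w, pi2 z = pi2 w -> pi1 (k2 z) = pi1 (k2 w)) ->
  (forall z, pi1 (k2 (k1 z)) = pi1 z) -> (forall z, pi2 (k1 (k2 z)) = pi2 z) ->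
  diffeomorphic Q1 Q2.
Proof.
move=> S1 S2 s1 s2 E1 E2 K1 K2.
have [f [sf fE]] := subduction_descent S1 (smooth_comp s1 S2.1) E1.
have [g [sg gE]] := subduction_descent S2 (smooth_comp s2 S1.1) E2.
exists f, g; split=> // q.
  by have [z <-] := subduction_surj q S1; rewrite fE gE /= K1.
by have [z <-] := subduction_surj q S2; rewrite gE fE /= K2.
Qed.

End Subductions.

Section Reductions.
Context {R : realType} (G : diffeologicalGroupType R) (X : momentSpace G).

Definition set_elt (T : Type) (A : set T) (x : T) (Ax : A x) : A :=
  exist (fun t => t \in A) x (mem_set Ax).

Lemma red_proj_subduction : subduction (@red_proj R G X).
Proof.
split=> n U P pP; last exact: pP.2.
have oU := plot_open pP; split=> // r Ur; exists U, P; split=> //.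
Qed.

Lemma red_projP (z w : zero_level X) :
  red_proj z = red_proj w <-> exists g, val w = act g (val z).
Proof.
by rewrite -orbitP; split=> [/(congr1 sval)//|E]; exact: red_eq.
Qed.

End Reductions.

Section Induction.
Context {R : realType} (G : diffeologicalGroupType R) (H : closedSubgroup G).
Local Notation HT := (subgroup_type H).
Local Notation incl := (@subgroup_incl R G H).
Context (X : momentSpace G) (Y : momentSpace HT).

(* The prefix double stands for reduction in stages, by H and then by G. *)
Definition double_level : set (X * (cotangent_bundle G * Y)) :=
  [set w | left_momentum w.2.1 = moment w.1 /\
           moment w.2.2 = restr H (right_momentum w.2.1)].

Lemma ind_zeroP (p : cotangent_bundle G) (y : Y) :
  zero_level (ind_total Y) (p, y) <-> moment y = restr H (right_momentum p).
Proof.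
rewrite /zero_level /=; split=> [/eqP|->]; last by rewrite subrr.
by rewrite subr_eq0 => /eqP.
Qed.

Lemma hom_ind_zeroP (x : X) (z : zero_level (ind_total Y)) :
  zero_level (prod_ms (opp_ms X) (Ind Y)) (x, red_proj z) <->
  left_momentum (val z).1 = moment x.
Proof.
rewrite /zero_level /= ind_momentE; split=> [/eqP|->]; last by rewrite addNr.
by rewrite addrC subr_eq0 => /eqP.
Qed.

Definition double_ind (w : double_level) : zero_level (ind_total Y) :=
  set_elt ((ind_zeroP (val w).2.1 (val w).2.2).2 (set_mem (valP w)).2).

Lemma val_double_ind w : val (double_ind w) = (val w).2.
Proof. by rewrite /=; case: (val w).2. Qed.

Lemma double_hom_subproof (w : double_level) :
  zero_level (prod_ms (opp_ms X) (Ind Y)) ((val w).1, red_proj (double_ind w)).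
Proof. exact/hom_ind_zeroP/(set_mem (valP w)).1. Qed.

Definition double_hom (w : double_level) : zero_level (prod_ms (opp_ms X) (Ind Y)) :=
  set_elt (double_hom_subproof w).

(** The [Ind Y] component of a plot lifts locally to the zero level in T^*G x Y. Paired with the [X]
    component it lands in [double_level], since the moment of a class is [left_momentum] of any
    representative. *)
Lemma double_hom_subduction : subduction double_hom.
Proof.
split=> [n U P [p1 p2]|n U P [p1 p2] r Ur].
  split=> //; apply: (red_proj_subduction (ind_total Y)).1.
  apply: plot_ext p2 _ => t _; exact: esym (val_double_ind _).
have [V [L [Vr VU pL PL]]] := (red_proj_subduction (ind_total Y)).2 _ _ _ p2 r Ur.
have lev t : V t -> double_level ((val (P t)).1, val (L t)).
  move=> Vt; split.
    apply/hom_ind_zeroP; rewrite -(PL _ Vt) -surjective_pairing.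
    exact: set_mem (valP (P t)).
  apply/ind_zeroP; rewrite -surjective_pairing.
  exact: set_mem (valP (L t)).
(* The pair lies in the double level only over V, hence the default value. *)
pose M t : double_level := if pselect (V t) is left Vt then set_elt (lev t Vt)
                           else set_elt (lev r Vr).
have ME t : V t -> val (M t) = ((val (P t)).1, val (L t)).
  by rewrite /M; case: pselect.
exists V, M; split=> //.
  apply: (@plot_ext _ _ n V (fun t => ((val (P t)).1, val (L t)))) => [|t /ME //].
  by split=> //; exact: plot_sub p1 (plot_open pL) VU.
move=> t Vt; apply: val_inj => /=; rewrite ME //=.
rewrite [LHS]surjective_pairing (PL _ Vt); congr pair; congr red_proj.
by apply: val_inj; rewrite val_double_ind ME.
Qed.

(** Reduction in stages has the orbits of G x H as fibres: [g] matches classes in [Ind Y], and [h]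
    matches their representatives. *)
Lemma double_hom_projP (w w' : double_level) :
  red_proj (double_hom w) = red_proj (double_hom w') <->
  exists g h, val w' = (act g (val w).1,
    (ltrans g (rtrans (val w).2.1 (incl h)^-1%g), act h (val w).2.2)).
Proof.
rewrite red_projP; split=> [[g] [E1 E2]|[g [h E]]]; exists g.
  (* The point (p', y') lies in its own H-orbit, which [E2] identifies with the g-translate of the
     orbit of (p, y); this yields [h]. *)
  have : sval (red_proj (double_ind w')) (val w').2.
    by rewrite -val_double_ind; exists 1%g => //; exact: act1.
  rewrite [sval _]E2.
  move=> [_ [h _ <-] E]; exists h.
  by rewrite [LHS]surjective_pairing E1 -E.
congr pair; rewrite ?E //; apply: red_eq; rewrite /= E /=.
(* The two orbits are matched by the index shifts k to k h and k to k h^-1. *)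
apply/seteqP; split=> [_ [k _ <-]|_ [_ [k _ <-] <-]].
  exists (act (k * h)%g (val (double_ind w))); first by exists (k * h)%g.
  by rewrite /= -lrtrans -rtransM -invgM actM.
exists (k * h^-1)%g => //=; rewrite -lrtrans -rtransM -invgM -actM.
by rewrite -[(incl _ * incl h)%g]/(incl (k * h^-1 * h)%g) mulgVK.
Qed.

Lemma left_momentum_base1 (p : cotangent_bundle G) :
  base p = 1%g -> left_momentum p = covector p.
Proof. by move=> p1; rewrite /left_momentum p1 invg1 rtrans1. Qed.

Lemma right_momentum_base1 (p : cotangent_bundle G) :
  base p = 1%g -> right_momentum p = covector p.
Proof. by move=> p1; rewrite /right_momentum p1 invg1 ltrans1. Qed.

(** The covector q^-1 p sits over 1, where it is its own left momentum; equivariance of the left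
    momentum concludes. *)
Lemma right_momentum_coAd (p : cotangent_bundle G) :
  right_momentum p = coAd (base p)^-1%g (left_momentum p).
Proof. by rewrite -left_momentum_ltrans left_momentum_base1 //= mulVg. Qed.

Definition moment_at1 (x : X) : cotangent_bundle G :=
  CotangentBundle (moment_cotangent x).

Lemma left_momentum_at1 x : left_momentum (moment_at1 x) = moment x.
Proof. exact: left_momentum_base1. Qed.

Lemma right_momentum_at1 x : right_momentum (moment_at1 x) = moment x.
Proof. exact: right_momentum_base1. Qed.

(** This is equivariance of the moment map; it makes [res_double] send H-orbits into orbits of G x
    H. *)
Lemma moment_at1_act g x :
  moment_at1 (act g x) = ltrans g (rtrans (moment_at1 x) g^-1%g).
Proof.
apply: cotangent_bundle_eq; rewrite /= ?mul1g ?mulgV //.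
rewrite (copull_comp _ (smooth_mulgl _) (smooth_mulgr _)); last by rewrite mulg1.
rewrite moment_equivariant /coAd.
by apply: copull_eq => // a; rewrite /= invgK.
Qed.

(** It shows that [w] is the translate by q of [res_double (double_res w)]. *)
Lemma moment_at1_translate (p : cotangent_bundle G) x :
  left_momentum p = moment x ->
  moment_at1 (act (base p)^-1%g x) = ltrans (base p)^-1%g p.
Proof.
move=> px; apply: cotangent_bundle_eq; first by rewrite /= mulVg.
by rewrite -[RHS]/(right_momentum p) right_momentum_coAd px -moment_equivariant.
Qed.

(** The base point is constantly 1, so injectivity of a chart freezes its coordinates [u]: each
    component is the moment along one fixed vector of T_1 G. *)
Lemma moment_at1_smooth :
  (forall Z, tangent (1%g : G) Z -> Csmooth (fun x : X => moment x Z)) ->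
  smooth moment_at1.
Proof.
move=> sPhi n U P pP; split; first exact: plot_cst (plot_open pP).
move=> d W c [pc injc _ _] V u oV VU cu uW E i k.
(* Localising only supplies a point [r] of [V] to fix that vector; the neighbourhood is [V]
   itself. *)
apply: Ck_local => r Vr; exists V => //.
have tZ : tangent (1%g : G) (velocity c (u r) (delta_mx 0 i)).
  by rewrite [1%g](E r Vr); exact: velocity_tangent pc (uW r Vr).
apply: Ck_ext (sPhi _ tZ n V P (plot_sub pP oV VU) k) => // s Vs /=.
by rewrite (injc (u s) (u r)) //; [exact: uW|exact: uW|rewrite -!E].
Qed.

Lemma hom_res_zeroP (x : X) (y : Y) :
  zero_level (prod_ms (opp_ms (Res H X)) Y) (x, y) <->
  moment y = restr H (moment x).
Proof.
rewrite /zero_level /=; split=> [/eqP|->]; last by rewrite addNr.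
by rewrite addrC subr_eq0 => /eqP.
Qed.

Lemma double_res_subproof (w : double_level) :
  zero_level (prod_ms (opp_ms (Res H X)) Y)
    (act (base (val w).2.1)^-1%g (val w).1, (val w).2.2).
Proof.
have [px yp] := set_mem (valP w); apply/hom_res_zeroP.
by rewrite yp right_momentum_coAd px moment_equivariant.
Qed.

Definition double_res (w : double_level) :=
  set_elt (double_res_subproof w).

Lemma res_double_subproof (z : zero_level (prod_ms (opp_ms (Res H X)) Y)) :
  double_level ((val z).1, (moment_at1 (val z).1, (val z).2)).
Proof.
split=> /=; first exact: left_momentum_at1.
rewrite right_momentum_at1; apply/hom_res_zeroP.
by rewrite -surjective_pairing; exact: set_mem (valP z).
Qed.

Definition res_double (z : zero_level (prod_ms (opp_ms (Res H X)) Y)) :=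
  set_elt (res_double_subproof z).

Lemma frobenius_reciprocity :
  smooth (fun gx : G * X => act gx.1 gx.2) ->
  (forall Z, tangent (1%g : G) Z -> Csmooth (fun x : X => moment x Z)) ->
  diffeomorphic (intertwiner_space X (Ind Y)) (intertwiner_space (Res H X) Y).
Proof.
move=> sact sPhi.
have S1 := subduction_comp double_hom_subduction
  (red_proj_subduction (prod_ms (opp_ms X) (Ind Y))).
have S2 := red_proj_subduction (prod_ms (opp_ms (Res H X)) Y).
apply: (subduction_diffeomorphic (k1 := double_res) (k2 := res_double) S1 S2).
- move=> n U P [p1 [[p2 _] p3]]; split=> //.
  apply: (sact n U (fun r => ((base (val (P r)).2.1)^-1%g, (val (P r)).1))).
  by split=> //; exact: (@invg_smooth R G n U (fun r => base (val (P r)).2.1)).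
- move=> n U P [p1 p2]; split=> //; split=> //.
  exact: (moment_at1_smooth sPhi p1).
(* The new base is g q h^-1, whose inverse takes g x to h q^-1 x, so [g] cancels. *)
- move=> w w' /double_hom_projP[g [h E]]; apply/red_projP; exists h.
  rewrite /= E /=; congr pair.
  by rewrite !invgM invgK -!actM -!mulgA mulVg mulg1.
(* Taking [h] in both factors keeps the base at h 1 h^-1 = 1. *)
- move=> z z' /red_projP[h E]; apply/double_hom_projP; exists (incl h), h.
  by rewrite /= E /= moment_at1_act.
- move=> w; apply/double_hom_projP; exists (base (val w).2.1), 1%g.
  have [px _] := set_mem (valP w).
  rewrite /= moment_at1_translate // act1 invg1 rtrans1 -ltransM -actM mulgV.
  by rewrite ltrans1 act1 -!surjective_pairing.
- move=> z; congr red_proj; apply: val_inj.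
  by rewrite /= invg1 act1 -surjective_pairing.
Qed.

End Induction.

Theorem theorem4p1 (R : realType) (G : lieGroupType R) (H : closedSubgroup G)
    (X : hamiltonianSpace G) (Y : hamiltonianSpace (subgroup_type H)) :
  diffeomorphic (intertwiner_space X (Ind Y)) (intertwiner_space (Res H X) Y).
Proof.
apply: frobenius_reciprocity; first exact: ham_act_smooth (ham_formP X).
exact: ham_moment_smooth (ham_formP X).
Qed.
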